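(* For all integers $k\ge 0$ and $0\le l\le n$ and every real $x$, $$\frac{d^{l}B_k^n(x)}{dx^{l}}=\frac{n!}{(n-l)!}\sum_{j=0}^{l}(-1)^{l-j}\binom{l}{j}B_{k-j}^{n-l}(x),$$ where $B_k^n$ denotes the Bernstein basis function.
   Context: The Bernstein basis functions are $B_k^n(x)=\binom{n}{k}x^k(1-x)^{n-k}$ for integers $0\le k\le n$, with the convention that $B_k^n(x)=0$ when $k<0$ or $k>n$ (and $0^0=1$). *)

(* Defs.v *)
From Stdlib Require Import Reals ZArith.
From Coquelicot Require Import Coquelicot.

Open Scope R_scope.

(** The index [k] is an integer because the convention [B_k^n = 0] outside
    [0 <= k <= n] is also needed for negative [k]. [0 ^ 0 = 1] holds for [pow].
    [Binomial.C] is qualified since Coquelicot uses [C] for complex numbers. *)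
Definition bernstein (n : nat) (k : Z) (x : R) : R :=
  if ((0 <=? k)%Z && (k <=? Z.of_nat n)%Z)%bool
  then Binomial.C n (Z.to_nat k) * x ^ (Z.to_nat k) * (1 - x) ^ (n - Z.to_nat k)
  else 0.

(* Main.v *)
(** Differentiating once gives [(B_k^(n+1))' = (n+1) (B_(k-1)^n - B_k^n)] for
    every integer [k], so each derivative lowers the degree and applies one
    backward difference in [k]; iterating, the [l]-th difference expands into
    the alternating binomial sum by Pascal's rule. *)
Require Import Defs.
From Stdlib Require Import Reals ZArith.
From Coquelicot Require Import Coquelicot.
From Stdlib Require Import Lra Lia.

Open Scope R_scope.

Lemma bernstein_in (n i : nat) (x : R) :
  (i <= n)%nat ->
  bernstein n (Z.of_nat i) x = Binomial.C n i * x ^ i * (1 - x) ^ (n - i).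
Proof.
intros H; unfold bernstein.
rewrite (proj2 (Z.leb_le 0 (Z.of_nat i))) by lia.
rewrite (proj2 (Z.leb_le (Z.of_nat i) (Z.of_nat n))) by lia.
now rewrite Nat2Z.id.
Qed.

Lemma bernstein_out (n : nat) (k : Z) (x : R) :
  (k < 0 \/ Z.of_nat n < k)%Z -> bernstein n k x = 0.
Proof.
intros H; unfold bernstein.
destruct (Z.leb_spec 0 k); destruct (Z.leb_spec k (Z.of_nat n)); simpl; trivial.
lia.
Qed.

(** This absorption identity and the next one turn the exponent brought down by differentiating
    [x ^ i] or [(1 - x) ^ (S n - i)] into the common factor [S n]. *)
Lemma C_absorb_l (n i : nat) :
  (i <= n)%nat ->
  INR (S i) * Binomial.C (S n) (S i) = INR (S n) * Binomial.C n i.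
Proof.
intros H; unfold Binomial.C.
replace (S n - S i)%nat with (n - i)%nat by lia.
rewrite !fact_simpl, !mult_INR.
field; repeat split; try apply INR_fact_neq_0; apply not_0_INR; lia.
Qed.

Lemma C_absorb_r (n i : nat) :
  (i <= n)%nat ->
  INR (S n - i) * Binomial.C (S n) i = INR (S n) * Binomial.C n i.
Proof.
intros H; unfold Binomial.C.
replace (S n - i)%nat with (S (n - i)) by lia.
rewrite !fact_simpl, !mult_INR.
field; repeat split; try apply INR_fact_neq_0; apply not_0_INR; lia.
Qed.

Lemma is_derive_bernstein (n : nat) (k : Z) (x : R) :
  is_derive (bernstein (S n) k) x
    (INR (S n) * (bernstein n (k - 1) x - bernstein n k x)).
Proof.
(* If [k < 0] or [k > S n], then [k] and [k - 1] both lie outside the range [0..n], so all three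
   functions vanish. *)
destruct (Z_lt_ge_dec k 0) as [Hk|Hk].
{ rewrite !bernstein_out by lia.
  apply is_derive_ext with (fun _ => 0).
  - intros t; rewrite bernstein_out by lia; trivial.
  - auto_derive; trivial; ring. }
destruct (Z_lt_ge_dec (Z.of_nat (S n)) k) as [Hn|Hn].
{ rewrite !bernstein_out by lia.
  apply is_derive_ext with (fun _ => 0).
  - intros t; rewrite bernstein_out by lia; trivial.
  - auto_derive; trivial; ring. }
rewrite <- (Z2Nat.id k) in * by lia.
revert Hk Hn; generalize (Z.to_nat k) as i; intros i _ Hn.
apply is_derive_ext with
  (fun t => Binomial.C (S n) i * t ^ i * (1 - t) ^ (S n - i)).
{ intros t; rewrite bernstein_in by lia; trivial. }
auto_derive; trivial.
(* [Hl] and [Hr] are the two terms of the product rule. At the ends [i = 0] and [i = S n] the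
   exponent brought down is zero, in agreement with the convention at the indices [-1] and [S n] in
   degree [n]. *)
assert (Hl : INR i * Binomial.C (S n) i * x ^ pred i * (1 - x) ^ (S n - i)
             = INR (S n) * bernstein n (Z.of_nat i - 1) x).
{ destruct i as [|i].
  - rewrite bernstein_out by lia; simpl INR; ring.
  - replace (Z.of_nat (S i) - 1)%Z with (Z.of_nat i) by lia.
    rewrite bernstein_in by lia.
    rewrite C_absorb_l by lia; simpl pred.
    replace (S n - S i)%nat with (n - i)%nat by lia; ring. }
assert (Hr : INR (S n - i) * Binomial.C (S n) i * x ^ i
               * (1 - x) ^ pred (S n - i)
             = INR (S n) * bernstein n (Z.of_nat i) x).
{ destruct (Nat.eq_dec i (S n)) as [->|Hi].
  - rewrite bernstein_out, Nat.sub_diag by lia; simpl INR; ring.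
  - rewrite bernstein_in by lia.
    rewrite C_absorb_r by lia.
    replace (pred (S n - i)) with (n - i)%nat by lia; ring. }
rewrite Rmult_minus_distr_l, <- Hl, <- Hr.
(* [auto_derive] leaves the subtraction unfolded; folding it back lets [ring] see a single atom. *)
change (match i with 0%nat => S n | S j => (n - j)%nat end) with (S n - i)%nat.
unfold Rminus; ring.
Qed.

(** Shifting the index in the [g (S j)] part and collecting coefficients gives Pascal's rule. For
    [g j] the Bernstein function of index [k - j], the bracket is the one in the derivative
    formula. *)
Lemma sum_binomial_difference (g : nat -> R) (l : nat) :
  sum_f_R0 (fun j => (-1) ^ (S l - j) * Binomial.C (S l) j * g j) (S l)
  = sum_f_R0 (fun j => (-1) ^ (l - j) * Binomial.C l j * (g (S j) - g j)) l.
Proof.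
rewrite (sum_eq _ (fun j => (-1) ^ (l - j) * Binomial.C l j * g (S j)
                     - (-1) ^ (l - j) * Binomial.C l j * g j) l)
  by (intros; ring).
rewrite minus_sum.
destruct l as [|l].
{ unfold Binomial.C; simpl; field. }
(* End terms are split off until all three sums run over [g (S j)] with [j <= l], where [pascal],
   which needs [j < S l], applies. *)
rewrite decomp_sum by lia; simpl pred; rewrite tech5.
rewrite (tech5 (fun j => _ * g (S j))).
rewrite (decomp_sum (fun j => _ * g j)) by lia; simpl pred.
rewrite (sum_eq _ (fun j => (-1) ^ (S l - j) * Binomial.C (S l) j * g (S j)
                     - (-1) ^ (S l - S j) * Binomial.C (S l) (S j) * g (S j)) l).
2:{ intros j Hj; rewrite <- pascal by lia.
    replace (S (S l) - S j)%nat with (S (l - j)) by lia.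
    replace (S l - j)%nat with (S (l - j)) by lia.
    replace (S l - S j)%nat with (l - j)%nat by lia.
    simpl; ring. }
rewrite minus_sum, !Nat.sub_diag, !Nat.sub_0_r, !C_n_0, !C_n_n.
simpl; ring.
Qed.

Lemma is_derive_sum_f_R0 (f : nat -> R -> R) (f' : nat -> R) (n : nat) (x : R) :
  (forall j, is_derive (f j) x (f' j)) ->
  is_derive (fun t => sum_f_R0 (fun j => f j t) n) x (sum_f_R0 f' n).
Proof.
intros H; induction n as [|n IH]; simpl.
- apply H.
- apply (is_derive_plus (V := R_NormedModule)); [exact IH | apply H].
Qed.

Theorem theorem7 (k l n : nat) (hln : (l <= n)%nat) (x : R) :
  is_derive_n (bernstein n (Z.of_nat k)) l x
    (INR (fact n) / INR (fact (n - l)) *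
     sum_f_R0 (fun j : nat =>
       (-1) ^ (l - j) * Binomial.C l j *
       bernstein (n - l) (Z.of_nat k - Z.of_nat j)%Z x) l).
Proof.
(* The hypothesis is needed at every point, because the [l]-th derivative is itself differentiated
   as a function. *)
revert x; induction l as [|l IH]; intros x.
{ simpl; rewrite C_n_0, Nat.sub_0_r, Z.sub_0_r.
  field; apply INR_fact_neq_0. }
specialize (IH ltac:(lia)).
cbv beta iota delta [is_derive_n].
eapply is_derive_ext.
{ intros t; symmetry; apply is_derive_n_unique, IH. }
rewrite (sum_binomial_difference
           (fun j => bernstein (n - S l) (Z.of_nat k - Z.of_nat j) x)).
(* The degree before differentiating is a successor [S m], as [is_derive_bernstein] requires. Its
   factor [S m] then turns [n! / (m+1)!] into [n! / m!]. *)
replace (n - l)%nat with (S (n - S l)) by lia.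
generalize (n - S l)%nat as m; intros m.
replace (INR (fact n) / INR (fact m))
  with (INR (fact n) / INR (fact (S m)) * INR (S m)).
2:{ rewrite fact_simpl, mult_INR.
    field; split; [apply INR_fact_neq_0 | apply not_0_INR; lia]. }
(* The factor [S m] moves inside the sum so that each summand matches the derivative of one
   Bernstein function. *)
rewrite Rmult_assoc, scal_sum.
apply is_derive_scal, is_derive_sum_f_R0; intros j.
replace (Z.of_nat k - Z.of_nat (S j))%Z with (Z.of_nat k - Z.of_nat j - 1)%Z by lia.
rewrite Rmult_assoc, (Rmult_comm _ (INR (S m))).
apply is_derive_scal, is_derive_bernstein.
Qed.
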